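(* Let $T = \langle S, Act, \to\rangle$ be a labelled transition system. Then for all states $s, s' \in S$: $s$ and $s'$ are similar in $T$ if and only if $s$ and $s'$ are similar in the Kripke structure $\mathsf{ks}(T)$.
   Context: A Kripke structure is $K=\langle S, AP, \to, L\rangle$ with $S$ a set of states, $AP$ a set of atomic propositions, $\to\,\subseteq S\times S$ a total transition relation (for every $s\in S$ there is $t\in S$ with $s\to t$), and $L: S\to 2^{AP}$ a state labelling. A labelled transition system (LTS) is $T=\langle S, Act, \to\rangle$ with $S$ a set of states, $Act$ a set of actions, a special silent action $\tau\notin Act$, and a transition relation $\to\,\subseteq S\times(Act\cup\{\tau\})\times S$ that is total (for every $s\in S$ there are $a\in Act$, $t\in S$ with $s\xrightarrow{a}t$). The embedding $\mathsf{ks}$: for an LTS $T=\langle S,Act,\to\rangle$, $\mathsf{ks}(T)=\langle S', AP, \to', L\rangle$ where $S' = S\cup\{(s,a,t)\in\,\to \mid a\neq\tau\}$ (the non-$\tau$ transitions become states), $AP = Act\cup\{\bot\}$ with $\bot\notin Act$ fresh, $\to'$ is the least relation such that for every transition $(s,a,t)$ with $a\neq\tau$ we have $s\to'(s,a,t)$ and $(s,a,t)\to' t$, and $s\to' t$ whenever $s\xrightarrow{\tau}t$; and $L(s)=\{\bot\}$ for $s\in S$, $L((s,a,t))=\{a\}$. Simulation in a Kripke structure: a relation $B\subseteq S\times S$ is a simulation iff for all $(s,s')\in B$: $L(s)=L(s')$, and for every $t$ with $s\to t$ there is $t'$ with $s'\to t'$ and $(t,t')\in B$. Simulation in an LTS: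 $B\subseteq S\times S$ is a simulation iff for all $(s,s')\in B$, all $a\in Act\cup\{\tau\}$ and all $t$ with $s\xrightarrow{a}t$ there is $t'$ with $s'\xrightarrow{a}t'$ and $(t,t')\in B$. In either setting, states $s,s'$ are similar iff there are simulations $B$, $B'$ with $(s,s')\in B$ and $(s',s)\in B'$. *)

(* Defs.v *)
From Stdlib Require Import Ensembles Relations.

Set Implicit Arguments.
Unset Strict Implicit.

Record kripke : Type := Kripke {
  ks_state : Type;
  ks_ap    : Type;
  ks_trans : relation ks_state;
  ks_label : ks_state -> Ensemble ks_ap;
  ks_total : forall s, exists t, ks_trans s t
}.

(* Act + {tau} is [option lts_act], with tau = [None]: hence tau is never an
   element of Act. Totality asks for a visible action, i.e. a in Act. *)
Record lts : Type := LTS {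
  lts_state : Type;
  lts_act   : Type;
  lts_trans : lts_state -> option lts_act -> lts_state -> Prop;
  lts_total : forall s, exists (a : lts_act) (t : lts_state),
                lts_trans s (Some a) t
}.

Definition ks_simulation (K : kripke) (B : relation (ks_state K)) : Prop :=
  forall s s', B s s' ->
    ks_label s = ks_label s' /\
    (forall t, ks_trans s t -> exists t', ks_trans s' t' /\ B t t').

Definition ks_similar (K : kripke) (s s' : ks_state K) : Prop :=
  exists B B' : relation (ks_state K),
    ks_simulation B /\ ks_simulation B' /\ B s s' /\ B' s' s.

Definition lts_simulation (T : lts) (B : relation (lts_state T)) : Prop :=
  forall s s', B s s' ->
    forall (a : option (lts_act T)) t, lts_trans s a t ->
      exists t', lts_trans s' a t' /\ B t t'.

Definition lts_similar (T : lts) (s s' : lts_state T) : Prop :=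
  exists B B' : relation (lts_state T),
    lts_simulation B /\ lts_simulation B' /\ B s s' /\ B' s' s.

Section Embedding.
Variable T : lts.

(* The disjoint union of S and the non-tau transitions; the proof argument of
   [of_trans] is unique up to proof irrelevance. *)
Inductive emb_state : Type :=
  | of_state (s : lts_state T)
  | of_trans (s : lts_state T) (a : lts_act T) (t : lts_state T)
             (h : lts_trans s (Some a) t).

Inductive emb_trans : emb_state -> emb_state -> Prop :=
  | emb_enter s a t (h : lts_trans s (Some a) t) :
      emb_trans (of_state s) (of_trans h)
  | emb_leave s a t (h : lts_trans s (Some a) t) :
      emb_trans (of_trans h) (of_state t)
  | emb_tau s t (h : lts_trans s None t) :
      emb_trans (of_state s) (of_state t).

(* AP = Act + {bot} is [option (lts_act T)], with bot = [None]. This [None] is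
   unrelated to tau. *)
Definition emb_label (x : emb_state) : Ensemble (option (lts_act T)) :=
  match x with
  | of_state _ => Singleton _ None
  | @of_trans _ a _ _ => Singleton _ (Some a)
  end.

Lemma emb_total : forall x, exists y, emb_trans x y.
Proof.
intros [s | s a t h].
- destruct (lts_total s) as [a [t h]]. exists (of_trans h). apply emb_enter.
- exists (of_state t). apply emb_leave.
Qed.

Definition ks : kripke := Kripke emb_label emb_total.

End Embedding.

(* Main.v *)
(** An LTS simulation [B] extends to the embedding by relating two transition
    states whenever they carry the same action and have [B]-related targets.
    Conversely a Kripke simulation restricts to the original states: labels
    separate these from the transition states, so a visible step, which the
    embedding splits in two, is matched by two steps that form a single visible
    step with the same action. *)

From Stdlib Require Import Ensembles Relations.
Require Import Defs.

Lemma Singleton_inj (U : Type) (x y : U) :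
  Singleton U x = Singleton U y -> x = y.
Proof.
intros e.
assert (hy : In U (Singleton U x) y) by (rewrite e; constructor).
now destruct hy.
Qed.

Section Embedding.
Variable T : lts.

(** Only endpoints are recorded, so case analysis never yields an equality between the proofs stored
    in transition states. *)
Lemma emb_trans_cases (x y : emb_state T) :
  emb_trans x y ->
  match x, y with
  | of_state s, of_state t => lts_trans s None t
  | of_state s, @of_trans _ s0 _ _ _ => s = s0
  | @of_trans _ _ _ t0 _, of_state t => t0 = t
  | of_trans _, of_trans _ => False
  end.
Proof. now intros []. Qed.

(** Sources are left free: the steps out of a transition state depend on its target alone. *)
Definition emb_lift (B : relation (lts_state T)) : relation (emb_state T) :=
  fun x y =>
  match x, y with
  | of_state s, of_state s' => B s s'
  | @of_trans _ _ a t _, @of_trans _ _ a' t' _ => a = a' /\ B t t'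
  | _, _ => False
  end.

Lemma emb_lift_simulation (B : relation (lts_state T)) :
  lts_simulation B -> @ks_simulation (ks T) (emb_lift B).
Proof.
intros simB [s | s a t h] [s' | s' a' t' h'] hB; try contradiction; simpl in hB.
- split; [reflexivity |].
  intros [u | s0 a u h] step; apply emb_trans_cases in step.
  + destruct (simB s s' hB None u step) as [u' [hu' Bu]].
    exists (of_state u'); split; [now apply emb_tau | exact Bu].
  + subst s0.
    destruct (simB s s' hB (Some a) u h) as [u' [hu' Bu]].
    exists (of_trans hu'); split; [apply emb_enter | now split].
- destruct hB as [<- Bt]; split; [reflexivity |].
  intros [u | s0 b u k] step; apply emb_trans_cases in step; [| contradiction].
  subst u.
  exists (of_state t'); split; [apply emb_leave | exact Bt].
Qed.

Definition emb_restrict (C : relation (emb_state T)) : relation (lts_state T) :=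
  fun s s' => C (of_state s) (of_state s').

Lemma emb_restrict_simulation (C : relation (emb_state T)) :
  @ks_simulation (ks T) C -> lts_simulation (emb_restrict C).
Proof.
intros simC s s' hC [a |] t h; destruct (simC _ _ hC) as [_ stepC].
- destruct (stepC _ (emb_enter h)) as [y [step Cy]].
  destruct (simC _ _ Cy) as [eL stepC'].
  (* Equal labels force [y] to be a transition state with action [a]; its stored proof [h'] is the
     matching visible step. *)
  destruct y as [u | s0 a' t' h']; simpl in eL; apply Singleton_inj in eL;
    [discriminate | injection eL as <-].
  apply emb_trans_cases in step; subst s0.
  (* The only successor of [y] is [of_state t'], so the leaving step relates [t] to [t']. *)
  destruct (stepC' _ (emb_leave h)) as [z [step' Cz]].
  destruct z as [u | s0 b u k]; apply emb_trans_cases in step';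
    [subst u | contradiction].
  now exists t'.
- destruct (stepC _ (emb_tau h)) as [y [step Cy]].
  destruct (simC _ _ Cy) as [eL _].
  (* The label of [of_state t] prevents a silent step from being answered by entering a visible
     transition. *)
  destruct y as [t' | s0 a t' h']; simpl in eL; apply Singleton_inj in eL;
    [| discriminate].
  apply emb_trans_cases in step.
  now exists t'.
Qed.

End Embedding.

Theorem theorem3p6 (T : lts) (s s' : lts_state T) :
  lts_similar s s' <-> @ks_similar (ks T) (of_state s) (of_state s').
Proof.
split.
- intros [B [B' [simB [simB' [hB hB']]]]].
  exists (emb_lift T B), (emb_lift T B').
  split; [now apply emb_lift_simulation |].
  split; [now apply emb_lift_simulation |].
  now split.
- intros [C [C' [simC [simC' [hC hC']]]]].
  exists (emb_restrict T C), (emb_restrict T C').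
  split; [now apply emb_restrict_simulation |].
  split; [now apply emb_restrict_simulation |].
  now split.
Qed.
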